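(* Let $n\ge1$ and let $\mathbf{L}$ be a De~Morgan lattice. The Kalman $n$-prime filters on $\mathbf{L}$ are precisely the sets $h^{-1}[G]$ where $\langle\mathbf{M},G\rangle=(\boldsymbol{\mathcal{P}}_1)^i\times(\boldsymbol{\mathcal{K}}_1)^j$ for some integers $0\le i,j\le n$ with $i+j=n$ and $h\colon\mathbf{L}\to\mathbf{M}$ is a De~Morgan lattice homomorphism.
   Context: A De~Morgan lattice is a distributive lattice with unary $\neg$ satisfying $\neg\neg x=x$ and the De~Morgan laws. $\mathbf{DM}_1$ is the four-element De~Morgan lattice on $\{\mathsf f,\mathsf n,\mathsf b,\mathsf t\}$ with $\mathsf f<\mathsf n,\mathsf b<\mathsf t$, $\mathsf n,\mathsf b$ incomparable, $\neg\mathsf t=\mathsf f$, $\neg\mathsf n=\mathsf n$, $\neg\mathsf b=\mathsf b$. $\boldsymbol{\mathcal{P}}_1$ is the structure on the subalgebra $\{\mathsf t,\mathsf b,\mathsf f\}$ with designated set $\{\mathsf t,\mathsf b\}$; $\boldsymbol{\mathcal{K}}_1$ is the structure on $\{\mathsf t,\mathsf n,\mathsf f\}$ with designated set $\{\mathsf t\}$. The direct product of structures $\langle\mathbf{A}_k,F_k\rangle$ is $\langle\prod_k\mathbf{A}_k,\bigcap_k\pi_k^{-1}[F_k]\rangle$. An $n$-filter is an upset $F$ such that for every non-empty finite $Y$: if $\bigwedge X\in F$ for all non-empty $X\subseteq Y$ with $|X|\le n$, then $\bigwedge Y\in F$; an $n$-ideal is an $n$-filter of the order dual. A filter is $n$-prime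 if its complement is an $n$-ideal. An upset $F$ is Kalman if $((x\wedge\neg x)\wedge z)\vee u\in F$ implies $((y\vee\neg y)\wedge z)\vee u\in F$ for all $x,y,z,u$. *)

(* Defs.v *)
From HB Require Import structures.
From mathcomp Require Import all_boot all_order finmap.
From mathcomp Require Import boolp classical_sets.

Set Implicit Arguments.
Unset Strict Implicit.
Unset Printing Implicit Defensive.

Import Order.TTheory.

Local Open Scope order_scope.
Local Open Scope fset_scope.
Local Open Scope classical_set_scope.

HB.mixin Record DistrLattice_hasDeMorgan d T of Order.DistrLattice d T := {
  dneg : T -> T;
  dnegK : involutive dneg;
  dnegI : forall x y : T, dneg (x `&` y)%O = (dneg x `|` dneg y)%O;
  dnegU : forall x y : T, dneg (x `|` y)%O = (dneg x `&` dneg y)%O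
}.

#[short(type="deMorganType")]
HB.structure Definition DeMorgan d :=
  { T of DistrLattice_hasDeMorgan d T & Order.DistrLattice d T }.

Definition dm_morphism d (L : deMorganType d) d' (M : deMorganType d')
    (h : L -> M) : Prop :=
  [/\ Order.meet_morphism h, Order.join_morphism h & {morph h : x / dneg x}].

Inductive dm1 := DMf | DMn | DMb | DMt.

Definition dm1_pair (x : dm1) : bool * bool :=
  match x with
  | DMf => (false, false) | DMn => (true, false)
  | DMb => (false, true) | DMt => (true, true)
  end.

Definition pair_dm1 (p : bool * bool) : dm1 :=
  match p with
  | (false, false) => DMf | (true, false) => DMn
  | (false, true) => DMb | (true, true) => DMt
  end.

Lemma dm1_pairK : cancel dm1_pair pair_dm1. Proof. by case. Qed.

HB.instance Definition _ := Finite.copy dm1 (can_type dm1_pairK).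

Definition dm1_le (x y : dm1) : bool := [|| x == DMf, y == DMt | x == y].
Definition dm1_lt (x y : dm1) : bool := (y != x) && dm1_le x y.

(* The only incomparable elements are [DMn] and [DMb]. *)
Definition dm1_meet (x y : dm1) : dm1 :=
  if dm1_le x y then x else if dm1_le y x then y else DMf.
Definition dm1_join (x y : dm1) : dm1 :=
  if dm1_le x y then y else if dm1_le y x then x else DMt.

Definition dm1_neg (x : dm1) : dm1 :=
  match x with DMf => DMt | DMn => DMn | DMb => DMb | DMt => DMf end.

Fact dm1_display : Order.disp_t. Proof. exact: Order.Disp tt tt. Qed.

Lemma dm1_le_def x y : dm1_le x y = (dm1_meet x y == x).
Proof. by case: x; case: y. Qed.
Lemma dm1_lt_def x y : dm1_lt x y = (y != x) && dm1_le x y.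
Proof. by []. Qed.
Lemma dm1_meetC : commutative dm1_meet. Proof. by case; case. Qed.
Lemma dm1_joinC : commutative dm1_join. Proof. by case; case. Qed.
Lemma dm1_meetA : associative dm1_meet. Proof. by case; case; case. Qed.
Lemma dm1_joinA : associative dm1_join. Proof. by case; case; case. Qed.
Lemma dm1_joinKI y x : dm1_meet x (dm1_join x y) = x.
Proof. by case: x; case: y. Qed.
Lemma dm1_meetKU y x : dm1_join x (dm1_meet x y) = x.
Proof. by case: x; case: y. Qed.
Lemma dm1_meetUl : left_distributive dm1_meet dm1_join.
Proof. by case; case; case. Qed.
Lemma dm1_meetxx : idempotent_op dm1_meet. Proof. by case. Qed.

HB.instance Definition _ := Order.isMeetJoinDistrLattice.Build dm1_display dm1
  dm1_le_def dm1_lt_def dm1_meetC dm1_joinC dm1_meetA dm1_joinA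
  dm1_joinKI dm1_meetKU dm1_meetUl dm1_meetxx.

Lemma dm1_negK : involutive dm1_neg. Proof. by case. Qed.
Lemma dm1_negI (x y : dm1) :
  dm1_neg (x `&` y)%O = (dm1_neg x `|` dm1_neg y)%O.
Proof. by case: x; case: y. Qed.
Lemma dm1_negU (x y : dm1) :
  dm1_neg (x `|` y)%O = (dm1_neg x `&` dm1_neg y)%O.
Proof. by case: x; case: y. Qed.

HB.instance Definition _ := DistrLattice_hasDeMorgan.Build dm1_display dm1
  dm1_negK dm1_negI dm1_negU.

Record dm_subalgebra d (A : deMorganType d) (S : {pred A}) : Prop := {
  dm_subI : {in S &, forall x y : A, (x `&` y)%O \in S};
  dm_subU : {in S &, forall x y : A, (x `|` y)%O \in S};
  dm_subN : {in S, forall x : A, dneg x \in S}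
}.

Section SubAlgebra.
Context d (A : deMorganType d) (S : {pred A}) (SA : dm_subalgebra S).

(* The proof argument is what the instances below recover the closure
   properties from. *)
Definition dm_sub (_ : dm_subalgebra S) : Type := {x : A | x \in S}.

Local Notation sT := (dm_sub SA).

HB.instance Definition _ := SubChoice.on sT.
HB.instance Definition _ :=
  Order.SubChoice_isSubLattice.Build d A (fun x => x \in S) d sT
    (dm_subI SA) (dm_subU SA).

Let sub_valI (x y : sT) : val (x `&` y)%O = (val x `&` val y)%O.
Proof. by []. Qed.
Let sub_valU (x y : sT) : val (x `|` y)%O = (val x `|` val y)%O.
Proof. by []. Qed.

Let sub_meetUl : @left_distributive sT sT Order.meet Order.join.
Proof.
by move=> x y z; apply: val_inj; rewrite !(sub_valI, sub_valU) meetUl.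
Qed.

HB.instance Definition _ :=
  Order.Lattice_Meet_isDistrLattice.Build d sT sub_meetUl.

Definition sub_neg (x : sT) : sT := Sub (dneg (val x)) (dm_subN SA (valP x)).

Let sub_valN (x : sT) : val (sub_neg x) = dneg (val x).
Proof. by []. Qed.
Let sub_negK : involutive sub_neg.
Proof. by move=> x; apply: val_inj; rewrite !sub_valN dnegK. Qed.
Let sub_negI (x y : sT) : sub_neg (x `&` y)%O = (sub_neg x `|` sub_neg y)%O.
Proof. by apply: val_inj; rewrite sub_valU !sub_valN sub_valI dnegI. Qed.
Let sub_negU (x y : sT) : sub_neg (x `|` y)%O = (sub_neg x `&` sub_neg y)%O.
Proof. by apply: val_inj; rewrite sub_valI !sub_valN sub_valU dnegU. Qed.

HB.instance Definition _ := DistrLattice_hasDeMorgan.Build d sT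
  sub_negK sub_negI sub_negU.
End SubAlgebra.

Section PowerAlgebra.
Context d (A : deMorganType d) (k : nat).
Local Notation T := (k.-tupleprod[Order.seqprod_display d] A).

Definition pow_neg (x : T) : T := [tuple dneg (tnth x i) | i < k].

Let pow_negK : involutive pow_neg.
Proof. by move=> x; apply: eq_from_tnth => i; rewrite !tnth_mktuple dnegK. Qed.
Let pow_negI (x y : T) : pow_neg (x `&` y)%O = (pow_neg x `|` pow_neg y)%O.
Proof.
apply: eq_from_tnth => i.
by rewrite tnth_mktuple tnth_meet dnegI tnth_join !tnth_mktuple.
Qed.
Let pow_negU (x y : T) : pow_neg (x `|` y)%O = (pow_neg x `&` pow_neg y)%O.
Proof.
apply: eq_from_tnth => i.
by rewrite tnth_mktuple tnth_join dnegU tnth_meet !tnth_mktuple.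
Qed.

HB.instance Definition _ := DistrLattice_hasDeMorgan.Build _ T
  pow_negK pow_negI pow_negU.
End PowerAlgebra.

Section ProdAlgebra.
Context d d' (A : deMorganType d) (B : deMorganType d').
Local Notation T := (A *prod[Order.prod_display d d'] B)%type.

Definition prod_neg (x : T) : T := (dneg x.1, dneg x.2).

Let prod_negK : involutive prod_neg.
Proof. by case=> x y; rewrite /prod_neg /= !dnegK. Qed.
Let prod_negI (x y : T) : prod_neg (x `&` y)%O = (prod_neg x `|` prod_neg y)%O.
Proof. by rewrite /prod_neg !dnegI. Qed.
Let prod_negU (x y : T) : prod_neg (x `|` y)%O = (prod_neg x `&` prod_neg y)%O.
Proof. by rewrite /prod_neg !dnegU. Qed.

HB.instance Definition _ := DistrLattice_hasDeMorgan.Build _ T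
  prod_negK prod_negI prod_negU.
End ProdAlgebra.

Record dm_structure := DMStructure {
  dms_disp : Order.disp_t;
  dms_alg :> deMorganType dms_disp;
  designated : set dms_alg
}.
Arguments designated : clear implicits.

Definition dms_pow (A : dm_structure) (k : nat) : dm_structure :=
  @DMStructure _ (k.-tupleprod[Order.seqprod_display _] A)
    (\bigcap_(i : 'I_k) (fun x => tnth x i) @^-1` designated A).

Definition dms_prod (A B : dm_structure) : dm_structure :=
  @DMStructure _ (A *prod[Order.prod_display _ _] B)%type
    (fst @^-1` designated A `&` snd @^-1` designated B).

Definition P1_carrier : {pred dm1} := [pred x in [:: DMt; DMb; DMf]].
Definition K1_carrier : {pred dm1} := [pred x in [:: DMt; DMn; DMf]].

Lemma P1_subalgebra : dm_subalgebra P1_carrier.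
Proof. by split=> [[] []|[] []|[]]. Qed.
Lemma K1_subalgebra : dm_subalgebra K1_carrier.
Proof. by split=> [[] []|[] []|[]]. Qed.

Definition P1 : dm_structure :=
  @DMStructure _ (dm_sub P1_subalgebra) [set x | val x \in [:: DMt; DMb]].
Definition K1 : dm_structure :=
  @DMStructure _ (dm_sub K1_subalgebra) [set x | val x \in [:: DMt]].

Section Filters.
Context d (L : latticeType d).
Implicit Types (F I : set L) (X Y : {fset L}) (n : nat).

Definition upset F : Prop := forall x y, (x <= y)%O -> F x -> F y.

(* [L] may lack a top, so the meet starts from a chosen element of [X]. *)
Definition fmeet X (X0 : X != fset0) : L :=
  \big[Order.meet/xchoose (fset0Pn X X0)]_(x <- X) x.

Definition nfilter n F : Prop :=
  upset F /\
  forall Y (Y0 : Y != fset0),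
    (forall X (X0 : X != fset0),
        (X `<=` Y)%fset -> (#|` X| <= n)%N -> F (fmeet X0)) ->
    F (fmeet Y0).
End Filters.

Definition nideal d (L : latticeType d) (n : nat) (I : set L) : Prop :=
  @nfilter _ L^d n I.

(* Filters are the 1-filters; the empty set and the whole lattice qualify. *)
Definition nprime_filter d (L : latticeType d) (n : nat) (F : set L) : Prop :=
  nfilter 1 F /\ nideal n (~` F).

Definition kalman d (L : deMorganType d) (F : set L) : Prop :=
  forall x y z u : L,
    F (((x `&` dneg x) `&` z) `|` u)%O ->
    F (((y `|` dneg y) `&` z) `|` u)%O.

(* Main.v *)
Require Import Defs.
From mathcomp Require Import all_boot all_order finmap boolp classical_sets.

(** If [x_1, ..., x_m] lie outside an [n]-prime filter [F] while all their
    pairwise joins lie in [F], then [m <= n]: the join of the elements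
    [y_i = meet of the x_j, j <> i] is the meet of the pairwise joins, hence lies
    in [F], whereas any [m - 1] of the [y_i] have a common upper bound [x_k].
    When [m] is maximal, each [{y | y \/ x_i in F}] is prime, since a failure of
    primeness would split [x_i] in two, and [F] is their intersection.  The Kalman
    condition makes each of these prime filters contain every [y \/ ~y] or no
    [y /\ ~y], which is what is needed for it to be the preimage of the designated
    set under a homomorphism into [P1] or [K1].  Missing factors are supplied by
    the whole lattice, the preimage under the constant map [b] into [P1]. *)

Set Implicit Arguments.
Unset Strict Implicit.
Unset Printing Implicit Defensive.

Import Order.TTheory.

(** * Finite meets, filters and prime filters *)

Section Filters.
Local Open Scope order_scope.

Lemma fmeet_closed d (L : latticeType d) (G : set L) (Y : {fset L})
    (Y0 : Y != fset0) :
  (forall x y, G x -> G y -> G (x `&` y)) -> (forall y, y \in Y -> G y) ->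
  G (fmeet Y0).
Proof.
move=> GI GY; rewrite /fmeet big_seq.
by apply: big_ind => //; apply: GY; exact: xchooseP.
Qed.

Lemma fmeet_le d (L : latticeType d) (Y : {fset L}) (Y0 : Y != fset0) y :
  y \in Y -> fmeet Y0 <= y.
Proof.
rewrite /fmeet -[y \in Y]/(y \in enum_fset Y).
elim: (enum_fset Y) => // a s IH; rewrite inE big_cons => /predU1P[->|ys].
  exact: leIl.
by apply: (le_trans (leIr _ _)); exact: IH.
Qed.

(** Non-empty sets with at most one element are singletons, so the test over subsets of
    [[fset x; y]] only asks for [F x] and [F y]. *)
Lemma nfilter1P d (L : latticeType d) (F : set L) :
  nfilter 1 F <-> upset F /\ forall x y, F x -> F y -> F (x `&` y).
Proof.
split=> -[Fup FI]; split=> //.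
  move=> x y Fx Fy.
  have Y0 : [fset x; y]%fset != fset0.
    by apply/fset0Pn; exists x; rewrite !inE eqxx.
  apply: (Fup (fmeet Y0)); first by rewrite lexI !fmeet_le ?inE ?eqxx ?orbT.
  apply: FI => X X0 XY X1.
  have [a aX] := fset0Pn _ X0.
  have Xa b : b \in X -> b = a.
    move=> bX; apply: contraTeq X1 => ba; rewrite -ltnNge.
    by rewrite (cardfsD1 a) aX (cardfsD1 b) !inE ba bX.
  have -> : fmeet X0 = a.
    by apply: (@fmeet_closed _ _ (eq^~ a)) => // _ _ -> ->; rewrite meetxx.
  by move: (fsubsetP XY _ aX); rewrite !inE => /orP[]/eqP->.
move=> Y Y0 FY; apply: fmeet_closed => // y yY.
have X0 : [fset y]%fset != fset0 by apply/fset0Pn; exists y; rewrite inE.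
apply: (Fup (fmeet X0)); first by apply: fmeet_le; rewrite inE.
by apply: FY; rewrite ?fsub1set ?cardfs1.
Qed.

(* The empty set and the whole lattice are allowed. *)
Definition prime_filter d (L : latticeType d) (U : set L) : Prop :=
  [/\ upset U, forall x y, U x -> U y -> U (x `&` y) &
      forall x y, U (x `|` y) -> U x \/ U y].

(** If the join of [Y] is in every [W k], primeness puts some member of [Y] in each [W k]; one
    choice per [k] gives at most [#|I|] members, whose join is again in every [W k]. *)
Lemma nprime_filter_bigcap d (L : latticeType d) (I : finType)
    (W : I -> set L) :
  (0 < #|I|)%N -> (forall k, prime_filter (W k)) ->
  nprime_filter #|I| (\bigcap_k W k)%classic.
Proof.
move=> I_gt0 Wprime; split.
  apply/nfilter1P; split=> [x y xy Wx k _|x y Wx Wy k _]; case: (Wprime k).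
    by move=> Wup _ _; apply: Wup xy _; exact: Wx.
  by move=> _ WI _; apply: WI; [exact: Wx|exact: Wy].
split=> [x y xy NWx Wy|Y Y0 NW WY].
  by apply: NWx => k kT; case: (Wprime k) => Wup _ _; apply: Wup xy (Wy k kT).
have /choice[f fP] k : exists y, y \in Y /\ W k y.
  apply: contrapT => /forallNP NWY; case: (Wprime k) => _ _ WU.
  (* Finite meets in [L^d] are joins in [L], under which the complement of a prime filter is
     closed. *)
  suff : (~` W k)%classic (fmeet Y0) by apply; exact: WY.
  apply: fmeet_closed => [x y NWx NWy /WU[]//|y yY Wy].
  by apply: (NWY y).
pose X : {fset L^d} := [fset f k | k in I]%fset.
have fX k : f k \in X by apply/imfsetP; exists k.
have X0 : X != fset0.
  by have [k _] := card_gt0P I_gt0; apply/fset0Pn; exists (f k).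
apply: (NW X X0).
- by apply/fsubsetP=> _ /imfsetP[k _ ->]; case: (fP k).
- by rewrite (leq_trans (leq_imfset_card _ _ _)) //= cardE.
- move=> k _; case: (Wprime k) => Wup _ _.
  apply: Wup (fP k).2; rewrite -leEdual; exact: fmeet_le (fX k).
Qed.

(* [y i] is the meet of the [x j] with [j != i], [p] the meet of all [x j] and
   [q] the join of the [y i], which in a distributive lattice is the meet of
   the pairwise joins of the [x j].  The meet with [v] in the universal
   property of [q] makes the induction go through. *)
Lemma join_of_comeets d (L : distrLatticeType d) (F : set L) (x : nat -> L)
    (m : nat) :
  upset F -> (forall a b, F a -> F b -> F (a `&` b)) ->
  (forall i j, (i < m.+2)%N -> (j < m.+2)%N -> i != j -> F (x i `|` x j)) ->
  exists (y : nat -> L) (q : L),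
    [/\ forall i j, (i < m.+2)%N -> (j < m.+2)%N -> i != j -> y i <= x j,
        forall v w, (forall i, (i < m.+2)%N -> y i `&` v <= w) -> q `&` v <= w
      & F q].
Proof.
move=> Fup FI Fx.
suff [y [q [p [yx qv Fq _ _]]]] : exists (y : nat -> L) (q p : L),
    [/\ forall i j, (i < m.+2)%N -> (j < m.+2)%N -> i != j -> y i <= x j,
        forall v w, (forall i, (i < m.+2)%N -> y i `&` v <= w) -> q `&` v <= w,
        F q,
        forall j, (j < m.+2)%N -> p <= x j &
        forall u, (forall j, (j < m.+2)%N -> F (u `|` x j)) -> F (u `|` p)].
  by exists y, q.
elim: m => [|m IH] in Fx *.
  exists (fun i => if i == 0%N then x 1%N else x 0%N), (x 0%N `|` x 1%N).
  exists (x 0%N `&` x 1%N); split.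
  - by case=> [|[|//]] [|[|//]].
  - move=> v w yw; rewrite meetUl leUx.
    by rewrite (yw 1%N) // (yw 0%N).
  - exact: Fx.
  - by case=> [|[|//]] _; rewrite ?leIl ?leIr.
  - by move=> u Fu; rewrite joinIr; apply: FI; exact: Fu.
have [i j im jm|y [q [p [yx qv Fq px pu]]]] := IH.
  by apply: Fx; exact: leqW.
pose z := x m.+2.
have Fpz : F (z `|` p).
  by apply: pu => j jm; apply: Fx => //; [exact: leqW|rewrite gtn_eqF].
(* The comeet omitting the new element [z] is the old full meet [p]; the other comeets gain the
   factor [z]. *)
exists (fun i => if i == m.+2 then p else y i `&` z), ((q `&` z) `|` p), (p `&` z).
split.
- move=> i j; rewrite (ltnS i) (leq_eqVlt i) (ltnS j) (leq_eqVlt j).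
  case: eqP => [->|/eqP ni] /=.
    by case: eqP => [->|_ _ /= jm _]; [rewrite eqxx|exact: px].
  case: eqP => [->|_] /= im jm ij; first by rewrite leIr.
  by apply: le_trans (leIl _ _) _; exact: yx.
- move=> v w yw; rewrite meetUl leUx -meetA qv /=.
    by have := yw m.+2 (leqnn _); rewrite eqxx.
  move=> i im; rewrite meetA; have := yw i (leqW im).
  by rewrite ltn_eqF.
(* By distributivity the new [q] is the meet of [q \/ p] and [z \/ p]. *)
- rewrite joinIl; apply: FI => //; apply: Fup Fq; exact: leUl.
- move=> j; rewrite ltnS leq_eqVlt => /predU1P[->|jm]; first exact: leIr.
  by apply: le_trans (leIl _ _) _; exact: px.
- move=> u Fu; rewrite joinIr; apply: FI; last exact: Fu.
  by apply: pu => j jm; apply: Fu; exact: leqW.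
Qed.

(** * Co-orthogonal families, order dual to families of pairwise disjoint elements *)

Definition co_orthogonal d (L : latticeType d) (F : set L) (m : nat)
    (x : nat -> L) : Prop :=
  (forall i, (i < m)%N -> ~ F (x i)) /\
  (forall i j, (i < m)%N -> (j < m)%N -> i != j -> F (x i `|` x j)).

Lemma co_orthogonal_leq d (L : distrLatticeType d) (F : set L) (n m : nat)
    (x : nat -> L) :
  (0 < n)%N -> nprime_filter n F -> co_orthogonal F m x -> (m <= n)%N.
Proof.
move=> n_gt0 [/nfilter1P[Fup FI] [_ NFY]] [NFx Fxx].
rewrite leqNgt; apply/negP => nm.
(* Since [n >= 1], [n < m] forces [m >= 2], the range of [join_of_comeets]. *)
case: m => [|[|m]] in NFx Fxx nm *; [by []|by case: n n_gt0 nm {NFY} => [|[]]|].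
have [y [q [yx qv Fq]]] := join_of_comeets Fup FI Fxx.
pose Y : {fset L^d} := [fset y (val i) | i in 'I_m.+2]%fset.
have Y0 : Y != fset0 by apply/fset0Pn; exists (y 0%N); apply/imfsetP; exists ord0.
have qY : q <= fmeet Y0.
  rewrite -[q]meetxx; apply: qv => i im; apply: le_trans (leIl _ _) _.
  rewrite -leEdual; apply: fmeet_le; apply/imfsetP.
  by exists (Ordinal im).
apply: (NFY Y Y0) (Fup _ _ qY Fq) => X X0 XY Xn.
have /choice[g gP] (a : X) : exists i : 'I_m.+2, val a = y i.
  by have /imfsetP[i _ ->] := fsubsetP XY _ (valP a); exists i.
(* [X] has at most [n < m.+2] members, so some index [k] is not chosen by [g]; every member of [X]
   is then a [y i] with [i != k], hence below [x k]. *)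
have [k kg] : exists k, k \notin codom g.
  apply/existsP; apply: contraLR nm; rewrite negb_exists -leqNgt => /forallP gT.
  apply: leq_trans Xn; rewrite cardfE; apply: leq_trans (leq_image_card g _).
  rewrite -[X in (X <= _)%N]card_ord; apply: subset_leq_card.
  apply/fintype.subsetP => k _.
  by have := gT k; rewrite negbK.
move=> FX; apply: (NFx k (ltn_ord k)); apply: Fup FX.
apply: (@fmeet_closed _ L^d (fun a : L => a <= x k)) => [a b ka kb|a aX].
  by rewrite meetEdual leUx ka.
have /= -> := gP [` aX]%fset.
apply: yx => //; apply: contraNneq kg => gk.
by rewrite -(val_inj gk) codom_f.
Qed.

Lemma nprime_filter_co_orthogonal d (L : distrLatticeType d) (F : set L)
    (n : nat) (y0 : L) :
  (0 < n)%N -> nprime_filter n F -> ~ F y0 ->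
  exists (m : nat) (x : nat -> L),
    [/\ (m <= n)%N,
        forall i, (i < m)%N -> prime_filter (fun y => F (y `|` x i)) &
        forall y, (forall i, (i < m)%N -> F (y `|` x i)) -> F y].
Proof.
move=> n_gt0 nF NFy0; have [/nfilter1P[Fup FI] _] := nF.
pose P m := `[< exists x, co_orthogonal F m x >].
(* The family of length 0; [y0] fills the values of the total function. *)
have P0 : exists m, P m by exists 0%N; apply/asboolP; exists (fun=> y0).
have Pn m : P m -> (m <= n)%N by case/asboolP => x; exact: co_orthogonal_leq.
case: (ex_maxnP P0 Pn) => m /asboolP[x [NFx Fxx]] mmax.
have nolonger x' : ~ co_orthogonal F m.+1 x'.
  by move=> x'P; have /mmax := asboolT (ex_intro _ x' x'P); rewrite ltnn.
exists m, x; split; first by apply: Pn; apply/asboolP; exists x.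
  move=> i im; split.
  - by move=> a b ab; apply: Fup; exact: leU2.
  - by move=> a b Fa Fb; rewrite joinIl; exact: FI.
  - move=> a b Fab; apply: contrapT => /not_orP[NFa NFb].
    have Fax c k : (k < m)%N -> k != i -> F ((c `|` x i) `|` x k).
      by move=> km ki; apply: Fup (Fxx _ _ km im ki); rewrite joinC leU2 // leUr.
    (* The splitting of [x i]: [a \/ x i] replaces it and [b \/ x i] is appended at index [m],
       giving a co-orthogonal family longer than the maximum. *)
    pose x' k := if k == m then b `|` x i else
                 if k == i then a `|` x i else x k.
    have x'm : x' m = b `|` x i by rewrite /x' eqxx.
    have x'i : x' i = a `|` x i by rewrite /x' (ltn_eqF im) eqxx.
    have x'E k : (k < m)%N -> k != i -> x' k = x k.
      by move=> km /negPf ki; rewrite /x' (ltn_eqF km) ki.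
    apply: (nolonger x'); split=> [k|].
      rewrite ltnS leq_eqVlt => /predU1P[->|km]; first by rewrite x'm.
      by have [->|ki] := eqVneq k i; rewrite ?x'i // x'E //; exact: NFx.
    have Fk k : (k < m)%N -> F (x' m `|` x' k).
      move=> km; rewrite x'm; have [->|ki] := eqVneq k i.
        by rewrite x'i joinACA joinxx (joinC b).
      by rewrite x'E //; exact: Fax.
    have Fi k : (k < m)%N -> k != i -> F (x' i `|` x' k).
      by move=> km ki; rewrite x'i x'E //; exact: Fax.
    move=> j k; rewrite !ltnS (leq_eqVlt j) (leq_eqVlt k).
    move=> /predU1P[->|jm] /predU1P[->|km]; first by rewrite eqxx.
    + by move=> _; exact: Fk.
    + by move=> _; rewrite joinC; exact: Fk.
    have [->|ji] := eqVneq j i; first by rewrite eq_sym; exact: Fi.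
    have [->|ki jk] := eqVneq k i; first by rewrite joinC => _; exact: Fi.
    by rewrite !x'E //; exact: Fxx.
(* Otherwise [y] could be appended to the maximal family. *)
move=> y Fy; apply: contrapT => NFy.
apply: (nolonger (fun k => if k == m then y else x k)); split=> [k|j k].
  by rewrite ltnS leq_eqVlt; case: eqP => //= _; exact: NFx.
rewrite !ltnS (leq_eqVlt j) (leq_eqVlt k).
case: (eqVneq j m) => [->|_] /=; case: (eqVneq k m) => [->|_] //=.
- by move=> _ km _; exact: Fy.
- by move=> jm _ _; rewrite joinC; exact: Fy.
- exact: Fxx.
Qed.
End Filters.

(** * Kalman filters as intersections of complete or consistent prime filters *)

Section Kalman.
Local Open Scope order_scope.

Definition complete_set d (L : deMorganType d) (U : set L) : Prop :=
  forall x, U (x `|` dneg x).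

Definition consistent_set d (L : deMorganType d) (U : set L) : Prop :=
  forall x, ~ U (x `&` dneg x).

Lemma prime_filter_kalman d (L : deMorganType d) (U : set L) :
  prime_filter U -> complete_set U \/ consistent_set U -> kalman U.
Proof.
move=> [Uup UI UU] Utype x y z u /UU[Uxz|Uu]; last exact: Uup (leUr _ _) Uu.
case: Utype => [Ucomp|Ucons]; last by case: (Ucons x); exact: Uup (leIl _ _) Uxz.
by apply: (Uup _ _ (leUl _ _)); apply: UI => //; exact: Uup (leIr _ _) Uxz.
Qed.

(* For the prime filter [y |-> F (y `|` x i)], the Kalman condition is used
   with [u] absorbing both [x i] and [y `|` dneg y]. *)
Lemma kalman_nprime_bigcap d (L : deMorganType d) (F : set L) (n : nat) :
  (0 < n)%N -> nprime_filter n F -> kalman F ->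
  exists U : 'I_n -> set L,
    [/\ forall k, prime_filter (U k),
        forall k, complete_set (U k) \/ consistent_set (U k) &
        F = (\bigcap_k U k)%classic].
Proof.
move=> n_gt0 nF kF; have [/nfilter1P[Fup _] _] := nF.
have setT_prime : prime_filter (@setT L) by split=> //; left.
have [FT|/existsNP[y0 NFy0]] := pselect (forall y, F y).
  exists (fun=> setT); split=> //; first by left.
  by apply/seteqP; split.
have [m [x [mn Uprime UF]]] := nprime_filter_co_orthogonal n_gt0 nF NFy0.
exists (fun k : 'I_n => if (k < m)%N then (fun y => F (y `|` x k)) else setT).
split=> [k|k|].
- by case: ltnP => // km; exact: Uprime.
- case: ltnP => [km|_]; last by left.
  have [|/existsNP[y NFy]] := pselect (complete_set (fun y => F (y `|` x k))).
    by left.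
  right=> a Fa; apply: NFy.
  (* With [z] equal to [a /\ dneg a], the premise lies above [(a /\ dneg a) \/ x k], which is in
     [F], and the conclusion lies below [u]. *)
  apply: (Fup _ _ _ (kF a y (a `&` dneg a) ((y `|` dneg y) `|` x k) _)).
    by rewrite leUx lexx andbT; exact: le_trans (leIl _ _) (leUl _ _).
  by apply: Fup Fa; rewrite meetxx leU2 // leUr.
- apply/seteqP; split=> [y Fy k _|y Uy].
    by case: ltnP => // km; apply: Fup Fy; exact: leUl.
  apply: UF => i im; have := Uy (Ordinal (leq_trans im mn)) I.
  by rewrite /= im.
Qed.

(** * Prime filters as preimages under homomorphisms into [P1] and [K1] *)

Lemma asbool_primeI d (L : latticeType d) (U : set L) x y :
  prime_filter U -> `[< U (x `&` y) >] = `[< U x >] && `[< U y >].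
Proof.
move=> [Uup UI _]; rewrite -asbool_and; apply: asbool_equiv_eq.
split=> [Uxy|[]]; last exact: UI.
by split; [exact: Uup (leIl _ _) Uxy|exact: Uup (leIr _ _) Uxy].
Qed.

Lemma asbool_primeU d (L : latticeType d) (U : set L) x y :
  prime_filter U -> `[< U (x `|` y) >] = `[< U x >] || `[< U y >].
Proof.
move=> [Uup _ UU]; rewrite -asbool_or; apply: asbool_equiv_eq.
split=> [/UU//|[]]; [exact: Uup (leUl _ _)|exact: Uup (leUr _ _)].
Qed.

Lemma prime_filter_preimage d (L : latticeType d) d' (M : latticeType d')
    (h : L -> M) (D : set M) :
  Order.meet_morphism h -> Order.join_morphism h -> prime_filter D ->
  prime_filter (h @^-1` D)%classic.
Proof.
move=> hI hU [Dup DI DU]; split=> [x y xy|x y|x y]; rewrite /preimage /=.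
- by apply: Dup; rewrite -(meet_idPl xy) hI leIr.
- by rewrite hI; exact: DI.
- by rewrite hU; exact: DU.
Qed.

Lemma P1_prime : prime_filter (designated P1).
Proof.
split=> [[[] ?] [[] ?]|[[] ?] [[] ?]|[[] ?] [[] ?]] //; by [left|right].
Qed.

Lemma K1_prime : prime_filter (designated K1).
Proof.
split=> [[[] ?] [[] ?]|[[] ?] [[] ?]|[[] ?] [[] ?]] //; by [left|right].
Qed.

(** Membership of [x] and [dneg x] in [U] determines the value: both give [DMb], only [x] gives
    [DMt], only [dneg x] gives [DMf]. Completeness and primeness exclude neither. *)
Lemma P1_morphismP d (L : deMorganType d) (U : set L) :
  prime_filter U /\ complete_set U <->
  exists h : L -> P1, dm_morphism h /\ U = (h @^-1` designated P1)%classic.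
Proof.
split=> [[Uprime Ucomp]|[h [[hI hU hN] ->]]]; last first.
  split; first exact: prime_filter_preimage hI hU P1_prime.
  by move=> x; rewrite /preimage /= hU hN; case: (h x) => -[].
pose u x := `[< U x >].
have uI x y : u (x `&` y) = u x && u y by exact: asbool_primeI.
have uU x y : u (x `|` y) = u x || u y by exact: asbool_primeU.
have uN x : u x || u (dneg x) by rewrite -uU; exact/asboolP.
pose h x : P1 := if u x then
   if u (dneg x) then exist _ DMb isT else exist _ DMt isT
   else exist _ DMf isT.
exists h; split; first split.
- move=> x y; apply: val_inj; rewrite /h dnegI uI uU.
  by move: (uN x) (uN y); do 4![case: (u _)].
- move=> x y; apply: val_inj; rewrite /h dnegU uI uU.
  by move: (uN x) (uN y); do 4![case: (u _)].
- move=> x; apply: val_inj; rewrite /h dnegK.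
  by move: (uN x); do 2![case: (u _)].
- apply/seteqP; split=> x; rewrite /preimage /= /h.
    by move=> /asboolP; rewrite -/(u x) => ->; case: (u _).
  by have [/asboolP|] := boolP (u x).
Qed.

(** As for [P1], except that consistency excludes both memberships and neither gives [DMn]. *)
Lemma K1_morphismP d (L : deMorganType d) (U : set L) :
  prime_filter U /\ consistent_set U <->
  exists h : L -> K1, dm_morphism h /\ U = (h @^-1` designated K1)%classic.
Proof.
split=> [[Uprime Ucons]|[h [[hI hU hN] ->]]]; last first.
  split; first exact: prime_filter_preimage hI hU K1_prime.
  by move=> x; rewrite /preimage /= hI hN; case: (h x) => -[].
pose u x := `[< U x >].
have uI x y : u (x `&` y) = u x && u y by exact: asbool_primeI.
have uU x y : u (x `|` y) = u x || u y by exact: asbool_primeU.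
have uN x : ~~ (u x && u (dneg x)) by rewrite -uI; exact/asboolPn.
pose h x : K1 := if u x then exist _ DMt isT else
   if u (dneg x) then exist _ DMf isT else exist _ DMn isT.
exists h; split; first split.
- move=> x y; apply: val_inj; rewrite /h dnegI uI uU.
  by move: (uN x) (uN y); do 4![case: (u _)].
- move=> x y; apply: val_inj; rewrite /h dnegU uI uU.
  by move: (uN x) (uN y); do 4![case: (u _)].
- move=> x; apply: val_inj; rewrite /h dnegK.
  by move: (uN x); do 2![case: (u _)].
- apply/seteqP; split=> x; rewrite /preimage /= /h.
    by move=> /asboolP; rewrite -/(u x) => ->.
  by have [/asboolP|_] := boolP (u x); last by case: (u _).
Qed.

(** * Products of homomorphisms and the characterisation *)

Lemma dm_morphism_pow d (L : deMorganType d) (A : dm_structure) (k : nat)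
    (h : L -> dms_pow A k) :
  dm_morphism h <-> forall i : 'I_k, dm_morphism (fun x => tnth (h x) i : A).
Proof.
split=> [[hI hU hN] i|hi].
  by split=> [x y|x y|x]; rewrite ?hI ?hU ?hN ?tnth_meet ?tnth_join ?tnth_mktuple.
split=> [x y|x y|x]; apply: eq_from_tnth => i; case: (hi i) => hI hU hN.
- by rewrite tnth_meet hI.
- by rewrite tnth_join hU.
- by rewrite hN tnth_mktuple.
Qed.

Lemma dm_morphism_prod d (L : deMorganType d) (A B : dm_structure)
    (h : L -> dms_prod A B) :
  dm_morphism h <-> dm_morphism (fun x => (h x).1 : A) /\
                    dm_morphism (fun x => (h x).2 : B).
Proof.
split=> [[hI hU hN]|[[aI aU aN] [bI bU bN]]].
  by split; split=> [x y|x y|x]; rewrite ?hI ?hU ?hN.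
split=> [x y|x y|x]; rewrite [LHS]surjective_pairing.
- by rewrite aI bI.
- by rewrite aU bU.
- by rewrite aN bN.
Qed.
End Kalman.

Theorem mainTheorem5 (d : Order.disp_t) (L : deMorganType d) (n : nat)
    (hn : (1 <= n)%N) (F : set L) :
  (nprime_filter n F /\ kalman F) <->
  (exists i j : nat,
     [/\ (i <= n)%N, (j <= n)%N & (i + j)%N = n] /\
     let M := dms_prod (dms_pow P1 i) (dms_pow K1 j) in
     exists h : L -> M,
       dm_morphism h /\ F = (h @^-1` designated M)%classic).
Proof.
split=> [[nF kF]|[i [j [[_ _ ijn] [h [/dm_morphism_prod[hP hK] ->]]]]]].
  have [U [Uprime Utype ->]] := kalman_nprime_bigcap hn nF kF.
  (* Complete indices become [P1] factors; the remaining ones are consistent and become [K1]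
     factors. *)
  pose A := [set k | `[< complete_set (U k) >]]%SET.
  have /choice[f fP] (k : 'I_#|A|) : exists g : L -> P1,
      dm_morphism g /\ U (enum_val k) = (g @^-1` designated P1)%classic.
    apply/P1_morphismP; split=> //.
    by have := enum_valP k; rewrite inE => /asboolP.
  have /choice[g gP] (k : 'I_#|(~: A)%SET|) : exists g : L -> K1,
      dm_morphism g /\ U (enum_val k) = (g @^-1` designated K1)%classic.
    apply/K1_morphismP; split=> //.
    have := enum_valP k; rewrite !inE => /asboolPn NP.
    by case: (Utype (enum_val k)).
  have cardA : (#|A| + #|(~: A)%SET|)%N = n by rewrite cardsC card_ord.
  exists #|A|, #|(~: A)%SET|; split.
    by split=> //; rewrite -[leqRHS]card_ord; exact: max_card.
  pose h x : dms_prod (dms_pow P1 #|A|) (dms_pow K1 #|(~: A)%SET|) :=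
    ([tuple f k x | k < _], [tuple g k x | k < _]).
  exists h; split.
    apply/dm_morphism_prod; split; apply/dm_morphism_pow => k /=.
      have -> : (fun x => tnth [tuple f k x | k < #|A|] k) = f k.
        by apply: funext => x; rewrite tnth_mktuple.
      by case: (fP k).
    have -> : (fun x => tnth [tuple g k x | k < #|(~: A)%SET|] k) = g k.
      by apply: funext => x; rewrite tnth_mktuple.
    by case: (gP k).
  apply/seteqP; split=> x.
    move=> Ux; split=> k _ /=; rewrite /preimage /= tnth_mktuple.
      by have : U (enum_val k) x := Ux _ I; rewrite (fP k).2.
    by have : U (enum_val k) x := Ux _ I; rewrite (gP k).2.
  move=> [Dx Ex] k _; have [kA|kA] := boolP (k \in A).
    have := Dx (enum_rank_in kA k) I; rewrite /preimage /= tnth_mktuple => h_k.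
    by rewrite -(enum_rankK_in kA kA) (fP _).2.
  rewrite -finset.in_setC in kA.
  have := Ex (enum_rank_in kA k) I; rewrite /preimage /= tnth_mktuple => h_k.
  by rewrite -(enum_rankK_in kA kA) (gP _).2.
(* Each coordinate of [h] pulls its designated set back to a prime filter, so [W] has [i + j = n]
   members. *)
pose W (k : 'I_i + 'I_j) : set L := match k with
  | inl a => ((fun x => tnth (h x).1 a) @^-1` designated P1)%classic
  | inr b => ((fun x => tnth (h x).2 b) @^-1` designated K1)%classic end.
have -> : (h @^-1` designated (dms_prod (dms_pow P1 i) (dms_pow K1 j)) =
           \bigcap_k W k)%classic.
  apply/seteqP; split=> x; first by move=> [Dx Ex] [a|b] _; [exact: Dx|exact: Ex].
  by move=> Wx; split=> a _; [exact: (Wx (inl a))|exact: (Wx (inr a))].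
have WP a : prime_filter (W (inl a)) /\ complete_set (W (inl a)).
  apply/P1_morphismP; exists (fun x => tnth (h x).1 a); split=> //.
  by move/dm_morphism_pow: hP; apply.
have WK a : prime_filter (W (inr a)) /\ consistent_set (W (inr a)).
  apply/K1_morphismP; exists (fun x => tnth (h x).2 a); split=> //.
  by move/dm_morphism_pow: hK; apply.
have cardW : #|{: 'I_i + 'I_j}| = n by rewrite card_sum !card_ord.
have Wprime k : prime_filter (W k) by case: k => a; [case: (WP a)|case: (WK a)].
split; first by rewrite -cardW; apply: nprime_filter_bigcap; rewrite ?cardW.
(* The Kalman condition passes to intersections. *)
move=> x y z u Wx k _; apply: (prime_filter_kalman (Wprime k)) (Wx k I).
by case: k => a; [left; case: (WP a)|right; case: (WK a)].
Qed.
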